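(* Let $f=\frac1n\sum_{i=1}^n f_i:\mathbb{R}^d\to\mathbb{R}$ be convex and $L_f$-smooth with a nonempty set of minimizers, let $x^*$ be a fixed minimizer of $f$, and let each $f_i:\mathbb{R}^d\to\mathbb{R}$ be convex and $L$-smooth. Let $\mathcal{P}$ be a proper uniform distribution over subsets of $\{1,\dots,n\}$ with expected minibatch size $\tau$, and let $\mathcal{A},\mathcal{B}\ge 0$ be constants such that $\mathbb{E}_{S\sim\mathcal{P}}\big[\|\sum_{i\in S}\frac{a_i}{p_i}\|^2\big]\le \mathcal{A}\sum_{i=1}^n\|a_i\|^2+\mathcal{B}\|\sum_{i=1}^n a_i\|^2$ for all $a_1,\dots,a_n\in\mathbb{R}^d$. Assume $\mathcal{B}L_f+4\mathcal{A}L/n>0$ and run Minibatch MISO with stepsize $\gamma=\frac{n}{2\tau(\mathcal{B}L_f+4\mathcal{A}L/n)}$. Then for every $k\ge 0$ and $x^a$ chosen uniformly at random from $\{x^0,x^1,\dots,x^k\}$ (uniformly random index, independent of the algorithm's randomness), $$\mathbb{E}[f(x^a)]-f(x^* )\le 2\left(\mathcal{B}L_f+\frac{4\mathcal{A}L}{n}\right)\frac{\|x^0-x^*\|^2+\frac{2\mathcal{A}\tau}{n^3}\mathcal{W}^0}{k+1},$$ where $\mathcal{W}^0=\sum_{i=1}^n\|\phi_i^0-x^*-\gamma f_i'(\phi_i^0)+\gamma f_i'(x^* )\|^2$.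
   Context: A differentiable function is $L$-smooth if its gradient is Lipschitz with constant $L\ge 0$; $f'$ and $f_i'$ denote gradients. $\|\cdot\|$ is the Euclidean norm. Sampling: for a distribution $\mathcal{P}$ over the $2^n$ subsets of $\{1,\dots,n\}$ and $S\sim\mathcal{P}$, put $p_i=\mathbb{P}(i\in S)$. $\mathcal{P}$ is proper if $p_i>0$ for all $i$, and uniform if $p_i=p_j$ for all $i,j$. The expected minibatch size is $\tau=\mathbb{E}[|S|]$. Minibatch MISO with stepsize $\gamma>0$: given arbitrary deterministic $\phi_1^0,\dots,\phi_n^0\in\mathbb{R}^d$, set $x^0=\frac1n\sum_{i=1}^n\phi_i^0-\frac{\gamma}{n}\sum_{i=1}^n f_i'(\phi_i^0)$. For $k=0,1,\dots$: draw $S^k\sim\mathcal{P}$ independently of the past; set $\phi_i^{k+1}=x^k$ if $i\in S^k$ and $\phi_i^{k+1}=\phi_i^k$ if $i\notin S^k$; set $x^{k+1}=\frac1n\sum_{i=1}^n\phi_i^{k+1}-\frac{\gamma}{n}\sum_{i=1}^n f_i'(\phi_i^{k+1})$. *)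

(* Defs.v *)
From HB Require Import structures.
From mathcomp Require Import all_boot all_order all_algebra.
From mathcomp Require Import all_classical all_reals all_analysis.

Set Implicit Arguments.
Unset Strict Implicit.
Unset Printing Implicit Defensive.

Import Order.TTheory GRing.Theory Num.Theory.
Import numFieldNormedType.Exports.

Local Open Scope classical_set_scope.
Local Open Scope ring_scope.

(* The library's norm on 'rV_d is the sup norm, which induces the same topology
   (hence the same notion of differentiability). *)
Definition enorm (R : realType) (d : nat) (x : 'rV[R]_d) : R :=
  Num.sqrt (\sum_(j < d) x ord0 j ^+ 2).

Definition gradient (R : realType) (d : nat) (g : 'rV[R]_d -> R)
    (x : 'rV[R]_d) : 'rV[R]_d :=
  \row_(j < d) 'D_(delta_mx ord0 j) g x.

Definition smooth (R : realType) (d : nat) (L : R) (g : 'rV[R]_d -> R) : Prop :=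
  (forall x, differentiable g x) /\
  (forall x y, enorm (gradient g x - gradient g y) <= L * enorm (x - y)).

Definition favg (R : realType) (n d : nat) (f : 'I_n -> 'rV[R]_d -> R)
    (x : 'rV[R]_d) : R :=
  n%:R^-1 * \sum_(i < n) f i x.

(* A distribution over subsets of 'I_n is given by its mass function. *)
Section Sampling.
Variables (R : realType) (n : nat).
Implicit Type p : {set 'I_n} -> R.

Definition sampling p : Prop :=
  (forall S, 0 <= p S) /\ \sum_(S : {set 'I_n}) p S = 1.

Definition sampling_mean p (X : {set 'I_n} -> R) : R :=
  \sum_(S : {set 'I_n}) p S * X S.

Definition incl_prob p (i : 'I_n) : R := \sum_(S : {set 'I_n} | i \in S) p S.

Definition proper_sampling p : Prop := forall i, 0 < incl_prob p i.

Definition uniform_sampling p : Prop :=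
  forall i j, incl_prob p i = incl_prob p j.

Definition batch_size p : R := sampling_mean p (fun S => #|S|%:R).

End Sampling.

Section MISO.
Variables (R : realType) (n d : nat).
Variables (f : 'I_n -> 'rV[R]_d -> R) (gamma : R).

Definition miso_point (phi : 'I_n -> 'rV[R]_d) : 'rV[R]_d :=
  n%:R^-1 *: (\sum_(i < n) phi i)
  - (gamma / n%:R) *: (\sum_(i < n) gradient (f i) (phi i)).

Fixpoint miso_phi (phi0 : 'I_n -> 'rV[R]_d) (S : nat -> {set 'I_n}) (k : nat)
    : 'I_n -> 'rV[R]_d :=
  if k is k'.+1 then
    fun i => if i \in S k' then miso_point (miso_phi phi0 S k')
             else miso_phi phi0 S k' i
  else phi0.

Definition miso_x (phi0 : 'I_n -> 'rV[R]_d) (S : nat -> {set 'I_n}) (k : nat)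
    : 'rV[R]_d :=
  miso_point (miso_phi phi0 S k).

End MISO.

Section Randomness.
Local Open Scope ereal_scope.
Variables (disp : measure_display) (Omega : measurableType disp).
Variables (R : realType) (P : probability Omega R) (n : nat).

Definition history (S : nat -> Omega -> {set 'I_n}) (s : nat -> {set 'I_n})
    (k : nat) : set Omega :=
  [set w | forall j, (j < k)%N -> S j w = s j].

Definition independent_draws (p : {set 'I_n} -> R)
    (S : nat -> Omega -> {set 'I_n}) : Prop :=
  [/\ forall k A, measurable (S k @^-1` [set A]),
      forall k A, P (S k @^-1` [set A]) = (p A)%:E &
      forall k s A, P (history S s k `&` S k @^-1` [set A]) =
                    P (history S s k) * P (S k @^-1` [set A])].

Definition uniform_index (k : nat) (a : Omega -> 'I_k.+1) : Prop :=
  (forall i, measurable (a @^-1` [set i])) /\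
  (forall i, P (a @^-1` [set i]) = (k.+1%:R^-1)%:E).

Definition independent_index (S : nat -> Omega -> {set 'I_n}) (k : nat)
    (a : Omega -> 'I_k.+1) : Prop :=
  forall i m s, P (a @^-1` [set i] `&` history S s m) =
                P (a @^-1` [set i]) * P (history S s m).

End Randomness.

(* Main.v *)
Require Import Defs.
From HB Require Import structures.
From mathcomp Require Import all_boot all_order all_algebra.
From mathcomp Require Import all_classical all_reals all_analysis.
From mathcomp Require Import ring lra.
Import Order.TTheory GRing.Theory Num.Theory.
Import numFieldNormedType.Exports.
Local Open Scope classical_set_scope.
Local Open Scope ring_scope.

(** The iterate of MISO is the average of the gradient steps
    [gstep i (phi i) = phi i - gamma *: gradient (f i) (phi i)] taken at the
    stored points. Write [q = tau / n] for the common inclusion probability and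
    [C = B * Lf + 4 * A * L / n]. The proof follows the potential
      [|x - xstar|^2 + c * sum_i |gstep i (phi i) - gstep i xstar|^2],
    with [c = 2 * A * q / n^2] ([lyapunov]), whose value at the start is the
    numerator of the announced bound.

    One step of the algorithm changes the potential in three ways. The mean
    displacement of the iterate is [- q * gamma] times the gradient of the
    average, which by convexity earns at least [2 * q * gamma] times the
    optimality gap. The sampling noise costs, through the assumption on [A] and
    [B], squared gradient differences and the dispersion of the memory about
    its mean. Refreshing the sampled entries gives back a share [q] of that
    dispersion, and [c] is chosen so that the two dispersion terms cancel. The
    squared gradients that remain are bounded by the optimality gap
    ([gradient_diff_le_gap]: for a convex [L]-smooth function the squared
    gradient difference is at most [2 * L] times the gap to the tangent), and
    the stepsize, which satisfies [2 * q * gamma * C = 1], makes them consume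
    at most half of the gain. So the conditional mean of the potential drops by
    [q * gamma] times the optimality gap at each step ([lyapunov_drift]).

    The batches drawn up to a given time take finitely many values, so every
    expectation involved is a finite sum. Independence of a batch from the past
    turns the drop above into a telescoping sum ([miso_mean_sum_le]), and
    independence of the random index from the batches makes the expectation at
    the random iterate the average of the expectations over time
    ([expectation_random_iterate]). Dividing by [q * gamma * (k + 1)] gives the
    rate, as [1 / (q * gamma) = 2 * C]. *)

(** * Euclidean geometry *)

Section Dot.
Context {R : realType} {d : nat}.
Implicit Types u v w : 'rV[R]_d.

Definition dot u v : R := \sum_(j < d) u ord0 j * v ord0 j.

Lemma dotC u v : dot u v = dot v u.
Proof. by apply: eq_bigr => j _; rewrite mulrC. Qed.

Lemma dotDl u v w : dot (u + v) w = dot u w + dot v w.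
Proof. by rewrite -big_split; apply: eq_bigr => j _; rewrite mxE mulrDl. Qed.

Lemma dotZl a u v : dot (a *: u) v = a * dot u v.
Proof. by rewrite mulr_sumr; apply: eq_bigr => j _; rewrite mxE mulrA. Qed.

Lemma dotNl u v : dot (- u) v = - dot u v.
Proof. by rewrite -scaleN1r dotZl mulN1r. Qed.

Lemma dot0l v : dot 0 v = 0.
Proof. by rewrite -(scale0r 0) dotZl mul0r. Qed.

Lemma dotDr u v w : dot u (v + w) = dot u v + dot u w.
Proof. by rewrite !(dotC u) dotDl. Qed.

Lemma dotZr a u v : dot u (a *: v) = a * dot u v.
Proof. by rewrite !(dotC u) dotZl. Qed.

Lemma dotNr u v : dot u (- v) = - dot u v.
Proof. by rewrite !(dotC u) dotNl. Qed.

Lemma dot_suml (I : finType) (Q : pred I) (F : I -> 'rV[R]_d) v :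
  dot (\sum_(i | Q i) F i) v = \sum_(i | Q i) dot (F i) v.
Proof. by apply: (big_morph (dot^~ v)) => [x y|]; rewrite ?dotDl ?dot0l. Qed.

Lemma dotvv_ge0 u : 0 <= dot u u.
Proof. by apply: sumr_ge0 => j _; rewrite -expr2 sqr_ge0. Qed.

Lemma dotvv_eq0 u : dot u u = 0 -> u = 0.
Proof.
move=> /eqP; rewrite psumr_eq0 => [/allP u0|j _]; last by rewrite -expr2 sqr_ge0.
apply/rowP => j; rewrite mxE; apply/eqP.
by have := u0 j (mem_index_enum j); rewrite mulf_eq0 orbb.
Qed.

Lemma enorm_ge0 u : 0 <= enorm u.
Proof. exact: sqrtr_ge0. Qed.

Lemma enorm_sqr u : enorm u ^+ 2 = dot u u.
Proof.
rewrite /enorm; under eq_bigr do rewrite expr2.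
by rewrite sqr_sqrtr //; exact: dotvv_ge0.
Qed.

Definition dotE := (dotDl, dotDr, dotZl, dotZr, dotNl, dotNr).

Lemma enormD_sqr_le u v :
  enorm (u + v) ^+ 2 <= 2 * enorm u ^+ 2 + 2 * enorm v ^+ 2.
Proof.
have := dotvv_ge0 (u - v).
by rewrite !enorm_sqr !dotE (dotC v u); lra.
Qed.

(** This one-sided form is all the descent lemma asks of the Cauchy-Schwarz
    inequality; for [c > 0] it is the expansion of [0 <= dot w w] with
    [w = c *: v - u], and for [c = 0] the hypothesis forces [u = 0]. *)
Lemma dot_le_enorm c u v : 0 <= c -> enorm u <= c * enorm v ->
  dot u v <= c * dot v v.
Proof.
move=> c0 uv.
have {}uv : dot u u <= c ^+ 2 * dot v v.
  by rewrite -!enorm_sqr -exprMn lerXn2r ?nnegrE ?mulr_ge0 ?enorm_ge0.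
have [c_gt0|] := ltP 0 c; last first.
  move=> c_le0; have c_eq0 : c = 0 by apply/eqP; rewrite eq_le c_le0.
  move: uv; rewrite c_eq0 expr0n /= !mul0r => uv.
  by rewrite (@dotvv_eq0 u) ?dot0l //; apply/eqP; rewrite eq_le uv dotvv_ge0.
have := dotvv_ge0 (c *: v - u); rewrite !dotE (dotC v u) => h.
rewrite -(ler_pM2l c_gt0); move: h uv; rewrite expr2; lra.
Qed.

End Dot.

(** * Convex smooth functions *)

Section LineDerivative.
Context {R : realType} {d : nat}.
Variable g : 'rV[R]_d -> R.
Hypothesis g_diff : forall x, differentiable g x.

(** The gradient is defined by its partial derivatives; differentiability is
    what lets every other directional derivative be read off it. *)
Lemma derive_dot_gradient x v : 'D_v g x = dot (gradient g x) v.
Proof.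
rewrite deriveE // {1}(row_sum_delta v) linear_sum; apply: eq_bigr => j _.
by rewrite linearZ /= !mxE deriveE // mulrC.
Qed.

Lemma is_derive_line x v t :
  is_derive t (1:R) (fun s : R => g (x + s *: v))
    (dot (gradient g (x + t *: v)) v).
Proof.
have lineD : is_diff t (fun s : R => x + s *: v) ( *:%R ^~ v).
  have : is_diff t (cst x + *:%R ^~ v) (0 + *:%R ^~ v) by exact: is_diffD.
  by rewrite add0r.
have gl : is_diff t (g \o (fun s : R => x + s *: v))
    ('d g (x + t *: v) \o *:%R ^~ v).
  by apply: is_diff_comp => //; apply: differentiableP.
have dgl : differentiable (g \o (fun s : R => x + s *: v)) t by [].
split; first exact: diff_derivable.
by rewrite deriveE // diff_val /= scale1r -deriveE // derive_dot_gradient.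
Qed.

End LineDerivative.

(** A convex function lies above its tangents: by [chord] the slope over a short
    step from [x] towards [y] is at most [g y - g x], and this passes to the
    limit. *)
Lemma convex_gradient_le {R : realType} {d : nat} {g : 'rV[R]_d -> R} :
  (forall x, differentiable g x) ->
  convex_function [set: 'rV[R]_d] (g : 'rV[R]_d -> R^o) ->
  forall x y, g x + dot (gradient g x) (y - x) <= g y.
Proof.
move=> g_diff g_convex x y.
have chord h : 0 < h -> h <= 1 ->
    g (h *: (y - x) + x) <= g x + h * (g y - g x).
  move=> h0 h1.
  have := @g_convex (Itv01 (ltW h0) h1) y x (mem_set I) (mem_set I).
  rewrite !convRE /conv /= => {}h2.
  rewrite (_ : h *: _ + x = h *: y + (1 - h) *: x); last first.
    by rewrite scalerBl scale1r scalerBr addrAC addrA.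
  by apply: le_trans h2 _; rewrite /unstable.onem; lra.
rewrite -lerBrDl -derive_dot_gradient//.
have gD : derivable g x (y - x) by exact: diff_derivable.
have limD : (h^-1 * (g (h *: (y - x) + x) - g x)) @[h --> (0:R)^'+]
    --> 'D_(y - x) g x
  by exact: cvg_dnbhs_at_right gD.
apply: (cvgr_to_le limD).
near=> h => /=.
have h0 : 0 < h by [].
rewrite mulrC ler_pdivrMr // mulrC lerBlDl chord //.
by near: h; apply: nbhs_right_le.
Unshelve. all: by end_near.
Qed.

(** The descent lemma, without integrals: [phi] below is the gap between [g] and
    its quadratic upper model along the segment, and [dphi <= 0] there, so the
    mean value theorem gives [phi 1 <= phi 0]. *)
Lemma smooth_upper_bound {R : realType} {d : nat} {g : 'rV[R]_d -> R} {L : R} x v :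
  smooth L g -> 0 <= L ->
  g (x + v) <= g x + dot (gradient g x) v + L / 2 * dot v v.
Proof.
move=> [g_diff g_lip] L0.
pose K := L * dot v v.
pose phi := (fun s : R => g (x + s *: v))
   - dot (gradient g x) v \*: (id : R -> R) - (K / 2) \*: (id ^+ 2 : R -> R).
pose dphi (s : R) :=
  dot (gradient g (x + s *: v)) v - dot (gradient g x) v - s * K.
have phiD (s : R) : is_derive s (1:R) phi (dphi s).
  have H := is_derive_line g g_diff x v s.
  apply: is_derive_eq; rewrite /dphi /GRing.scale /= expr1; lra.
have phic : {within `[0, 1], continuous phi}.
  apply: continuous_subspaceT => s.
  by apply/differentiable_continuous/derivable1_diffP; case: (phiD s).
have [c + ] := MVT (@ltr01 R) (fun s _ => phiD s) phic.
rewrite in_itv /= => /andP[c0 c1].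
rewrite subr0 mulr1 /phi /= !fctE /= /dphi.
rewrite scale0r scale1r addr0 => E.
have : dot (gradient g (x + c *: v) - gradient g x) v <= c * L * dot v v.
  apply: dot_le_enorm; first by rewrite mulr_ge0 // ltW.
  apply: le_trans (g_lip _ _) _; rewrite addrAC subrr add0r.
  rewrite (mulrC c) -mulrA ler_wpM2l //.
  rewrite -(@ler_pXn2r _ 2) ?nnegrE ?mulr_ge0 ?enorm_ge0 ?(ltW c0) //.
  by rewrite exprMn !enorm_sqr !dotE; lra.
rewrite dotDl dotNl.
move: E; rewrite /GRing.scale /= /K !expr2; lra.
Qed.

(** Compare two bounds on [g] at the point reached from [x] by a gradient step of
    length [1 / L] on [g] minus its tangent at [y]: the tangent at [y] from
    below, the quadratic model at [x] from above. What is left is the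
    inequality. For [L = 0] the gradient is constant. *)
Lemma gradient_diff_le_gap {R : realType} {d : nat} {g : 'rV[R]_d -> R} {L : R} x y :
  convex_function [set: 'rV[R]_d] (g : 'rV[R]_d -> R^o) ->
  smooth L g -> 0 <= L ->
  enorm (gradient g x - gradient g y) ^+ 2 <=
  2 * L * (g x - g y - dot (gradient g y) (x - y)).
Proof.
move=> gc gs L0; have [L_gt0|L_le0] := ltP 0 L; last first.
  have L_eq0 : L = 0 by apply/eqP; rewrite eq_le L_le0.
  have := gs.2 x y; rewrite L_eq0 mul0r mulr0 mul0r => h.
  by have -> : enorm (gradient g x - gradient g y) = 0
    by [apply/eqP; rewrite eq_le h enorm_ge0]; rewrite expr0n.
set w := gradient g x - gradient g y.
have lo := convex_gradient_le gs.1 gc y (x + - L^-1 *: w).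
have hi := smooth_upper_bound x (- L^-1 *: w) gs L0.
have ww : dot w w = dot (gradient g x) w - dot (gradient g y) w.
  by rewrite {1}/w dotDl dotNl.
move: (le_trans lo hi); rewrite enorm_sqr; clearbody w.
rewrite (addrAC x) !dotE ww.
set a := dot (gradient g x) w; set b := dot _ w => H.
rewrite -ler_pdivrMl ?mulr_gt0 //.
apply: le_trans (_ : L^-1 * (a - b) - (2 * L)^-1 * (a - b) <= _).
  by rewrite invfM; lra.
have E : L / 2 * (- L^-1 * (- L^-1 * (a - b))) = (2 * L)^-1 * (a - b).
  by field; apply: lt0r_neq0.
move: H; rewrite E; lra.
Qed.

Lemma gradient_favg (R : realType) (n d : nat) (f : 'I_n -> 'rV[R]_d -> R) x :
  (forall i, differentiable (f i) x) ->
  gradient (favg f) x = n%:R^-1 *: \sum_(i < n) gradient (f i) x.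
Proof.
move=> fD; apply/rowP => j; rewrite !mxE summxE.
under eq_bigr do rewrite mxE.
have -> : favg f = n%:R^-1 \*: (\sum_(i < n) f i).
  by apply/funext => z; rewrite /favg /= fct_sumE.
have fd i : is_derive x (delta_mx ord0 j) (f i) ('D_(delta_mx ord0 j) (f i) x).
  by apply: DeriveDef => //; exact: diff_derivable.
by rewrite derive_val.
Qed.

(** A gradient step from a minimizer would otherwise decrease [g]. The step
    [1 / (L + 1)] is below [2 / L] and stays meaningful for [L = 0]. *)
Lemma gradient_min {R : realType} {d : nat} {g : 'rV[R]_d -> R} {L : R} x :
  smooth L g -> 0 <= L -> (forall y, g x <= g y) -> gradient g x = 0.
Proof.
move=> gs L0 gmin; apply: dotvv_eq0; apply/eqP; rewrite eq_le dotvv_ge0 andbT.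
have L1 : 0 < L + 1 by lra.
have := smooth_upper_bound x (- (L + 1)^-1 *: gradient g x) gs L0.
move/(le_trans (gmin _)); rewrite !dotE.
set a := dot _ _ => h.
have E : L / 2 * (- (L + 1)^-1 * (- (L + 1)^-1 * a))
    = (L + 1)^-1 * a * (L / (L + 1) / 2).
  by field; apply: lt0r_neq0.
rewrite E mulNr in h.
have : L / (L + 1) <= 1 by rewrite ler_pdivrMr // mul1r; lra.
rewrite -(pmulr_rle0 _ (_ : 0 < (L + 1)^-1)) ?invr_gt0 //.
have : 0 <= (L + 1)^-1 * a by rewrite mulr_ge0 ?dotvv_ge0 // invr_ge0 ltW.
move: h; set b := (L + 1)^-1 * a; set t := L / (L + 1); nra.
Qed.

(** * Means over a random batch *)

Section SamplingMean.
Context {R : realType} {n : nat}.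
Variable p : {set 'I_n} -> R.

Lemma sampling_meanD X Y :
  sampling_mean p (fun S => X S + Y S) = sampling_mean p X + sampling_mean p Y.
Proof. by rewrite -big_split; apply: eq_bigr => S _; rewrite mulrDr. Qed.

Lemma sampling_meanZ a X :
  sampling_mean p (fun S => a * X S) = a * sampling_mean p X.
Proof. by rewrite mulr_sumr; apply: eq_bigr => S _; rewrite mulrCA. Qed.

Lemma sampling_mean_cst a : sampling p -> sampling_mean p (fun=> a) = a.
Proof. by case=> _ p1; rewrite /sampling_mean -mulr_suml p1 mul1r. Qed.

Lemma sampling_mean_sum (b : 'I_n -> R) :
  sampling_mean p (fun S => \sum_(i in S) b i) = \sum_(i < n) incl_prob p i * b i.
Proof.
rewrite /sampling_mean; under eq_bigr do rewrite mulr_sumr.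
rewrite (exchange_big_dep predT) //=.
by apply: eq_bigr => i _; rewrite mulr_suml.
Qed.

Lemma batch_size_sum : batch_size p = \sum_(i < n) incl_prob p i.
Proof.
transitivity (sampling_mean p (fun S => \sum_(i in S) 1)).
  by apply: eq_bigr => S _; rewrite sumr_const.
by rewrite sampling_mean_sum; apply: eq_bigr => i _; rewrite mulr1.
Qed.

End SamplingMean.

(** * One step of MISO *)

Section Step.
Context {R : realType} {n d : nat}.
Variables (f : 'I_n -> 'rV[R]_d -> R) (gamma : R).

Definition gstep i (y : 'rV[R]_d) := y - gamma *: gradient (f i) y.

(** MISO is an averaging method: its iterate is the mean of the gradient steps
    taken at the stored points. *)
Lemma miso_pointE phi :
  miso_point f gamma phi = n%:R^-1 *: \sum_(i < n) gstep i (phi i).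
Proof.
by rewrite /miso_point big_split /= sumrN -scaler_sumr scalerBr scalerA mulrC.
Qed.

(** One transition of the Markov chain of stored points, so that
    [miso_phi] at [k.+1] is [miso_step] applied to [miso_phi] at [k]. *)
Definition miso_step phi (S : {set 'I_n}) : 'I_n -> 'rV[R]_d :=
  fun i => if i \in S then miso_point f gamma phi else phi i.

Definition displacement phi i : 'rV[R]_d :=
  gstep i (miso_point f gamma phi) - gstep i (phi i).

Variables (xstar : 'rV[R]_d) (c : R).

Definition lyapunov phi : R :=
  enorm (miso_point f gamma phi - xstar) ^+ 2
  + c * \sum_(i < n) enorm (gstep i (phi i) - gstep i xstar) ^+ 2.

Lemma lyapunov_ge0 phi : 0 <= c -> 0 <= lyapunov phi.
Proof.
move=> c0; rewrite addr_ge0 ?sqr_ge0 // mulr_ge0 // sumr_ge0 // => i _.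
exact: sqr_ge0.
Qed.

(** The change of the potential is a sum over the batch, whose mean over a
    uniform batch is proportional to the full sum, plus the squared norm of a
    batch sum, which is the quantity that the sampling constants control. *)
Lemma lyapunov_step phi (S : {set 'I_n}) :
  let x := miso_point f gamma phi in
  let w := displacement phi in
  lyapunov (miso_step phi S) = lyapunov phi +
  \sum_(i in S) (2 / n%:R * dot (w i) (x - xstar)
    + c * (enorm (gstep i x - gstep i xstar) ^+ 2
           - enorm (gstep i (phi i) - gstep i xstar) ^+ 2))
  + n%:R^-1 ^+ 2 * enorm (\sum_(i in S) w i) ^+ 2.
Proof.
move=> x w.
have pointE : miso_point f gamma (miso_step phi S) =
    x + n%:R^-1 *: \sum_(i in S) w i.
  rewrite /x !miso_pointE -scalerDr; congr (_ *: _).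
  rewrite [in RHS](big_mkcond (mem S)) -big_split; apply: eq_bigr => i _ /=.
  rewrite /miso_step /w /displacement; case: ifP => _; last by rewrite addr0.
  by rewrite addrC subrK.
have memE : \sum_(i < n) enorm (gstep i (miso_step phi S i) - gstep i xstar) ^+ 2
    = \sum_(i < n) enorm (gstep i (phi i) - gstep i xstar) ^+ 2 +
      \sum_(i in S) (enorm (gstep i x - gstep i xstar) ^+ 2
           - enorm (gstep i (phi i) - gstep i xstar) ^+ 2).
  rewrite [in RHS](big_mkcond (mem S)) -big_split; apply: eq_bigr => i _ /=.
  rewrite /miso_step; case: ifP => _; last by rewrite addr0.
  by rewrite addrC subrK.
rewrite {1}/lyapunov pointE memE /lyapunov [X in _ = _ + X + _]big_split /=.
rewrite -!mulr_sumr -(dot_suml _ (mem S) w) -/x.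
move: (\sum_(i in S) w i) => s; rewrite addrAC !enorm_sqr.
move: (x - xstar) => r; rewrite !dotE (dotC r s); ring.
Qed.

End Step.

(** The scalar bookkeeping of the one-step bound. [delta] stands for the
    optimality gap, [D] for the inner product of the gradient with the vector
    from the minimizer to the iterate, [rr] for the squared norm of that vector,
    [Gam] and [GG] for squared gradients, [E] for the dispersion of the memory
    and [Sw] for the squared displacements. The weight [2 * A * q / m ^+ 2] of
    the memory term is the one for which [E] and [rr] cancel, and the stepsize
    makes the positive terms use up at most half of [2 * q * gamma * delta]. *)
Lemma drift_arith {R : realFieldType}
    {m q A B L Lf gamma V D E rr Gam GG Sw delta : R} :
  0 < m -> 0 < q -> 0 <= A -> 0 <= B -> 0 < B * Lf + 4 * A * L / m ->
  gamma = (2 * q * (B * Lf + 4 * A * L / m))^-1 ->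
  Sw <= 2 * gamma ^+ 2 * Gam + 2 * E ->
  Gam <= 2 * L * m * delta -> GG <= 2 * Lf * delta -> delta <= D -> 0 <= delta ->
  V + q * (2 / m * (- (gamma * m) * D) + 2 * A * q / m ^+ 2 *
     (m * rr - 2 * gamma * m * D + gamma ^+ 2 * Gam - (E + m * rr)))
  + (q / m) ^+ 2 * (A * Sw + B * ((gamma * m) ^+ 2 * GG))
  <= V - q * gamma * delta.
Proof.
move=> m0 q0 A0 B0 C0 gammaE Sw_le Gam_le GG_le D_ge delta0.
have g0 : 0 < gamma by rewrite gammaE invr_gt0 mulr_gt0 // mulr_gt0.
(* The choice of stepsize, in the form in which it is spent below. *)
have half : q * gamma * delta =
    2 * (q * gamma) ^+ 2 * (B * Lf + 4 * A * L / m) * delta.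
  have : 2 * (q * gamma) * (B * Lf + 4 * A * L / m) = 1.
    by rewrite gammaE mulrA -mulrAC mulfV // gt_eqF // mulr_gt0 // mulr_gt0.
  move=> h; transitivity (q * gamma * delta *
    (2 * (q * gamma) * (B * Lf + 4 * A * L / m))); first by rewrite h mulr1.
  ring.
have {}Sw_le : (q / m) ^+ 2 * A * Sw <=
    (q / m) ^+ 2 * A * (2 * gamma ^+ 2 * Gam + 2 * E).
  by apply: ler_wpM2l => //; rewrite mulr_ge0 // sqr_ge0.
have {}Gam_le : 4 * A * (q * gamma / m) ^+ 2 * Gam <=
    4 * A * (q * gamma / m) ^+ 2 * (2 * L * m * delta).
  by apply: ler_wpM2l => //; rewrite mulr_ge0 ?sqr_ge0 // mulr_ge0.
have {}GG_le : (q * gamma) ^+ 2 * B * GG <=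
    (q * gamma) ^+ 2 * B * (2 * Lf * delta).
  by apply: ler_wpM2l => //; rewrite mulr_ge0 ?sqr_ge0.
have qD_ge : 2 * q * gamma * delta <= 2 * q * gamma * D.
  by apply: ler_wpM2l => //; rewrite !mulr_ge0 ?(ltW q0) ?(ltW g0).
have AD_ge0 : 0 <= 4 * A * (q ^+ 2 * gamma / m) * D.
  apply: mulr_ge0; last exact: le_trans D_ge.
  by rewrite !mulr_ge0 ?invr_ge0 ?(ltW q0) ?(ltW g0) ?(ltW m0).
have m_neq0 : m != 0 by rewrite gt_eqF.
apply: (@le_trans _ _ (V - 2 * q * gamma * D - 4 * A * (q ^+ 2 * gamma / m) * D
   + 4 * A * (q * gamma / m) ^+ 2 * Gam + (q * gamma) ^+ 2 * B * GG)).
  have -> : V - 2 * q * gamma * D - 4 * A * (q ^+ 2 * gamma / m) * D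
      + 4 * A * (q * gamma / m) ^+ 2 * Gam + (q * gamma) ^+ 2 * B * GG =
    V + q * (2 / m * (- (gamma * m) * D) + 2 * A * q / m ^+ 2 *
       (m * rr - 2 * gamma * m * D + gamma ^+ 2 * Gam - (E + m * rr)))
    + (q / m) ^+ 2 * A * (2 * gamma ^+ 2 * Gam + 2 * E)
    + (q / m) ^+ 2 * (B * ((gamma * m) ^+ 2 * GG)) by field.
  by move: Sw_le; lra.
have E1 : 4 * A * (q * gamma / m) ^+ 2 * (2 * L * m * delta) =
  2 * (q * gamma) ^+ 2 * (4 * A * L / m) * delta by field.
rewrite E1 in Gam_le.
move: Gam_le GG_le qD_ge AD_ge0 half; lra.
Qed.

Section Drift.
Context {R : realType} {n d : nat}.
Variables (f : 'I_n -> 'rV[R]_d -> R) (Lf L : R).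
Hypotheses (n_gt0 : (0 < n)%N) (Lf_ge0 : 0 <= Lf) (L_ge0 : 0 <= L).
Hypothesis favg_convex :
  convex_function [set: 'rV[R]_d] (favg f : 'rV[R]_d -> R^o).
Hypothesis favg_smooth : smooth Lf (favg f).
Hypothesis f_convex :
  forall i, convex_function [set: 'rV[R]_d] (f i : 'rV[R]_d -> R^o).
Hypothesis f_smooth : forall i, smooth L (f i).
Variable xstar : 'rV[R]_d.
Hypothesis xstar_min : forall x, favg f xstar <= favg f x.

Let nR_gt0 : 0 < n%:R :> R. Proof. by rewrite ltr0n. Qed.
Let nR_neq0 : n%:R != 0 :> R. Proof. by rewrite gt_eqF. Qed.

Lemma sum_gradient x :
  \sum_(i < n) gradient (f i) x = n%:R *: gradient (favg f) x.
Proof.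
rewrite gradient_favg; last by move=> i; exact: (f_smooth i).1.
by rewrite scalerA divff // scale1r.
Qed.

Lemma gradient_xstar : gradient (favg f) xstar = 0.
Proof. exact: gradient_min favg_smooth Lf_ge0 xstar_min. Qed.

(** The tangent terms at [xstar] sum to [0], so the individual gaps add up to
    the gap of the average. *)
Lemma sum_gradient_diff_le x :
  \sum_(i < n) enorm (gradient (f i) x - gradient (f i) xstar) ^+ 2
  <= 2 * L * n%:R * (favg f x - favg f xstar).
Proof.
apply: (@le_trans _ _ (\sum_(i < n)
    2 * L * (f i x - f i xstar - dot (gradient (f i) xstar) (x - xstar)))).
  apply: ler_sum => i _; exact: gradient_diff_le_gap.
rewrite -mulr_sumr !sumrB -dot_suml sum_gradient gradient_xstar scaler0 dot0l subr0.
rewrite -(mulrA (2 * L)) /favg -mulrBr mulrA mulrA -(mulrA _ n%:R) divff // mulr1.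
by rewrite le_refl.
Qed.

Lemma favg_gradient_le x :
  enorm (gradient (favg f) x) ^+ 2 <= 2 * Lf * (favg f x - favg f xstar).
Proof.
have := gradient_diff_le_gap x xstar favg_convex favg_smooth Lf_ge0.
by rewrite gradient_xstar subr0 dot0l subr0.
Qed.

Lemma favg_gap_le x :
  favg f x - favg f xstar <= dot (gradient (favg f) x) (x - xstar).
Proof.
have := convex_gradient_le favg_smooth.1 favg_convex x xstar.
by rewrite -opprB dotNr; lra.
Qed.

Variables (p : {set 'I_n} -> R) (q A B gamma : R).
Hypothesis p_sampling : sampling p.
Hypothesis q_gt0 : 0 < q.
Hypothesis incl_probE : forall i, incl_prob p i = q.
Hypotheses (A_ge0 : 0 <= A) (B_ge0 : 0 <= B).
Hypothesis AB_bound : forall a : 'I_n -> 'rV[R]_d,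
    sampling_mean p
      (fun S => enorm (\sum_(i in S) (incl_prob p i)^-1 *: a i) ^+ 2)
    <= A * (\sum_(i < n) enorm (a i) ^+ 2) + B * enorm (\sum_(i < n) a i) ^+ 2.
Hypothesis AB_gt0 : 0 < B * Lf + 4 * A * L / n%:R.
Hypothesis gammaE : gamma = (2 * q * (B * Lf + 4 * A * L / n%:R))^-1.

Let c := 2 * A * q / n%:R ^+ 2.

Lemma lyapunov_mean_le phi :
  let x := miso_point f gamma phi in
  sampling_mean p (fun S => lyapunov f gamma xstar c (miso_step f gamma phi S))
  <= lyapunov f gamma xstar c phi
   + q * (2 / n%:R * dot (\sum_(i < n) displacement f gamma phi i) (x - xstar)
     + c * (\sum_(i < n) enorm (gstep f gamma i x - gstep f gamma i xstar) ^+ 2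
            - \sum_(i < n)
                enorm (gstep f gamma i (phi i) - gstep f gamma i xstar) ^+ 2))
   + (q / n%:R) ^+ 2 * (A * (\sum_(i < n) enorm (displacement f gamma phi i) ^+ 2)
       + B * enorm (\sum_(i < n) displacement f gamma phi i) ^+ 2).
Proof.
rewrite (funext (lyapunov_step f gamma xstar c phi)) /=.
rewrite 2!sampling_meanD sampling_mean_cst // sampling_mean_sum.
under [X in _ + X + _]eq_bigr do rewrite incl_probE.
rewrite -mulr_sumr big_split /= -!mulr_sumr sumrB -dot_suml lerD2l.
rewrite sampling_meanZ (_ : sampling_mean p _ = q ^+ 2 * sampling_mean p
  (fun S => enorm (\sum_(i in S)
      (incl_prob p i)^-1 *: displacement f gamma phi i) ^+ 2)).
  by rewrite mulrA -exprMn (mulrC n%:R^-1) ler_pM2l ?exprn_gt0 ?divr_gt0 //.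
rewrite -sampling_meanZ; apply: eq_bigr => S _; congr (_ * _).
under [in RHS]eq_bigr do rewrite incl_probE.
rewrite -scaler_sumr !enorm_sqr !dotE; field; exact: lt0r_neq0.
Qed.

(** Split each deviation [gstep i (phi i) - gstep i xstar] into the deviation
    [r] of the iterate, which is their mean, and a centred part [e i]. A
    displacement is then, up to sign, a scaled gradient difference plus [e i].
    The potential loses the squared norms of [e] at the rate at which the
    sampling noise feeds them in, so only gradient terms remain, and smoothness
    bounds those by the optimality gap. *)
Lemma lyapunov_drift phi :
  sampling_mean p (fun S => lyapunov f gamma xstar c (miso_step f gamma phi S))
  <= lyapunov f gamma xstar c phi
   - q * gamma * (favg f (miso_point f gamma phi) - favg f xstar).
Proof.
apply: le_trans (lyapunov_mean_le phi) _.
set x := miso_point f gamma phi; set V := lyapunov f gamma xstar c phi.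
have nx : \sum_(i < n) gstep f gamma i (phi i) = n%:R *: x.
  by rewrite /x miso_pointE scalerA divff // scale1r.
have dispE i : displacement f gamma phi i =
    gstep f gamma i x - gstep f gamma i (phi i) by [].
clearbody x.
pose r := x - xstar.
pose g i := gradient (f i) x - gradient (f i) xstar.
pose e i := gstep f gamma i (phi i) - gstep f gamma i xstar - r.
pose G := gradient (favg f) x.
have sum_g : \sum_(i < n) g i = n%:R *: G.
  by rewrite /g sumrB !sum_gradient gradient_xstar scaler0 subr0.
have sum_e : \sum_(i < n) e i = 0.
  have ns : \sum_(i < n) gstep f gamma i xstar = n%:R *: xstar.
    by rewrite sumrB sumr_const card_ord -scaler_nat -scaler_sumr sum_gradient
      gradient_xstar !scaler0 subr0.
  have nr : \sum_(i < n) r = n%:R *: r by rewrite sumr_const card_ord scaler_nat.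
  by rewrite 2!sumrB nx ns nr /r scalerBr subrr.
have uE i : gstep f gamma i (phi i) - gstep f gamma i xstar = e i + r.
  by rewrite /e subrK.
have vE i : gstep f gamma i x - gstep f gamma i xstar = r - gamma *: g i.
  by rewrite /gstep /r /g scalerBr !opprD !opprK addrACA.
have Gam_le : \sum_(i < n) enorm (g i) ^+ 2 <=
    2 * L * n%:R * (favg f x - favg f xstar) by exact: sum_gradient_diff_le.
have G_le : enorm G ^+ 2 <= 2 * Lf * (favg f x - favg f xstar).
  exact: favg_gradient_le.
have gap_le : favg f x - favg f xstar <= dot G r by exact: favg_gap_le.
have gap_ge0 : 0 <= favg f x - favg f xstar by rewrite subr_ge0.
rewrite -/r; clearbody g e G r.
have wE i : displacement f gamma phi i = - (gamma *: g i + e i).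
  have subBB (a b c' : 'rV[R]_d) : a - c' = a - b - (c' - b).
    by rewrite opprB addrA subrK.
  rewrite dispE (subBB _ (gstep f gamma i xstar)) vE uE.
  by rewrite (addrC (e i)) opprD addrACA subrr add0r opprD.
have sum_w : \sum_(i < n) displacement f gamma phi i = - (gamma * n%:R) *: G.
  under eq_bigr do rewrite wE.
  by rewrite sumrN big_split /= sum_e addr0 -scaler_sumr sum_g scalerA scaleNr.
pose E := \sum_(i < n) enorm (e i) ^+ 2.
pose Gam := \sum_(i < n) enorm (g i) ^+ 2.
have [rr rrE] : exists rr, rr = enorm r ^+ 2 by eexists.
have sum_r : \sum_(i < n) rr = n%:R * rr by rewrite sumr_const card_ord mulr_natl.
have normv : \sum_(i < n) enorm (gstep f gamma i x - gstep f gamma i xstar) ^+ 2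
    = n%:R * rr - 2 * gamma * n%:R * dot G r + gamma ^+ 2 * Gam.
  under eq_bigr => i _.
    have -> : enorm (gstep f gamma i x - gstep f gamma i xstar) ^+ 2
      = rr - 2 * gamma * dot (g i) r + gamma ^+ 2 * enorm (g i) ^+ 2.
      by rewrite vE rrE !enorm_sqr !dotE (dotC r (g i)); ring.
    over.
  by rewrite big_split sumrB -!mulr_sumr -dot_suml sum_g sum_r dotZl /= -/Gam; ring.
have normu :
    \sum_(i < n) enorm (gstep f gamma i (phi i) - gstep f gamma i xstar) ^+ 2
    = E + n%:R * rr.
  under eq_bigr => i _.
    have -> : enorm (gstep f gamma i (phi i) - gstep f gamma i xstar) ^+ 2
      = enorm (e i) ^+ 2 + 2 * dot (e i) r + rr.
      by rewrite uE rrE !enorm_sqr !dotE (dotC r (e i)); ring.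
    over.
  by rewrite !big_split -!mulr_sumr -dot_suml sum_e sum_r dot0l /= -/E; ring.
have normw : \sum_(i < n) enorm (displacement f gamma phi i) ^+ 2
    <= 2 * gamma ^+ 2 * Gam + 2 * E.
  rewrite /Gam /E !mulr_sumr -big_split; apply: ler_sum => i _ /=.
  have -> : 2 * gamma ^+ 2 * enorm (g i) ^+ 2 = 2 * enorm (gamma *: g i) ^+ 2.
    by rewrite !enorm_sqr dotZl dotZr; ring.
  rewrite wE; apply: le_trans _ (enormD_sqr_le _ _); rewrite le_eqVlt.
  by rewrite !enorm_sqr dotNl dotNr opprK eqxx.
(* The stored points enter the bound only through these four sums. *)
have key s Nv Nu Nw : s = - (gamma * n%:R) *: G ->
    Nv = n%:R * rr - 2 * gamma * n%:R * dot G r + gamma ^+ 2 * Gam ->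
    Nu = E + n%:R * rr -> Nw <= 2 * gamma ^+ 2 * Gam + 2 * E ->
    V + q * (2 / n%:R * dot s r + c * (Nv - Nu))
      + (q / n%:R) ^+ 2 * (A * Nw + B * enorm s ^+ 2)
    <= V - q * gamma * (favg f x - favg f xstar).
  move=> -> -> -> Nw_le.
  have -> : enorm (- (gamma * n%:R) *: G) ^+ 2
      = (gamma * n%:R) ^+ 2 * enorm G ^+ 2.
    by rewrite !enorm_sqr dotZl dotZr; ring.
  rewrite dotZl.
  exact: (drift_arith nR_gt0 q_gt0 A_ge0 B_ge0 AB_gt0 gammaE Nw_le Gam_le G_le
            gap_le gap_ge0).
exact: key sum_w normv normu normw.
Qed.

End Drift.

(** * Random variables with finitely many values *)

Section FiniteValued.
Context {R : realType} {disp : measure_display} {Omega : measurableType disp}.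
Variable P : probability Omega R.

Definition law {T : finType} (Z : Omega -> T) (t : T) : R :=
  fine (P (Z @^-1` [set t])).

Lemma law_ge0 {T : finType} (Z : Omega -> T) t : 0 <= law Z t.
Proof. exact: fine_ge0. Qed.

Lemma expectation_finite {T : finType} (Z : Omega -> T) (F : T -> R) :
  (forall t, measurable (Z @^-1` [set t])) ->
  ('E_P[fun w => F (Z w)] = (\sum_t law Z t * F t)%:E)%E.
Proof.
move=> mZ; rewrite unlock.
have E w : (F (Z w))%:E =
    (\sum_(t : T) (F t)%:E * (\1_(Z @^-1` [set t]) w)%:E)%E.
  rewrite (bigD1 (Z w)) //= big1 ?adde0 => [|t tZ].
    by rewrite indicE mem_set // mule1.
  by rewrite indicE memNset ?mule0 // => Zt; rewrite Zt eqxx in tZ.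
under eq_integral do rewrite E.
have iI t : P.-integrable [set: Omega] (fun w => (\1_(Z @^-1` [set t]) w : R)%:E).
  exact: integrable_indic.
rewrite integral_sum //; last by move=> t; apply: integrableZl.
rewrite -sumEFin; apply: eq_bigr => t _.
rewrite integralZl // integral_indic // setIT muleC EFinM /law fineK //.
exact: fin_num_measure.
Qed.

Lemma expectation_indep {T1 T2 : finType} (U : Omega -> T1) (V : Omega -> T2)
    (F : T1 -> T2 -> R) :
  (forall u, measurable (U @^-1` [set u])) ->
  (forall v, measurable (V @^-1` [set v])) ->
  (forall u v, P (U @^-1` [set u] `&` V @^-1` [set v]) =
     P (U @^-1` [set u]) * P (V @^-1` [set v]))%E ->
  ('E_P[fun w => F (U w) (V w)]
  = (\sum_u law U u * \sum_v law V v * F u v)%:E)%E.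
Proof.
move=> mU mV indep.
have fib u v : (fun w => (U w, V w)) @^-1` [set (u, v)]
    = U @^-1` [set u] `&` V @^-1` [set v].
  by apply/seteqP; split => w /= [-> ->].
rewrite (expectation_finite (fun w => (U w, V w)) (fun z => F z.1 z.2)); last first.
  by move=> [u v]; rewrite fib; apply: measurableI.
congr EFin; under [RHS]eq_bigr do rewrite mulr_sumr.
rewrite pair_bigA; apply: eq_bigr => -[u v] _ /=.
by rewrite /law fib indep fineM ?fin_num_measure // mulrA.
Qed.
End FiniteValued.

(** * MISO along independent draws *)

Section History.
Context {R : realType} {disp : measure_display} {Omega : measurableType disp}.
Context {n d : nat}.
Variables (P : probability Omega R) (p : {set 'I_n} -> R).
Variable S : nat -> Omega -> {set 'I_n}.
Hypothesis S_draws : independent_draws P p S.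

Definition hist k (w : Omega) : {ffun 'I_k -> {set 'I_n}} :=
  [ffun t : 'I_k => S t w].

(** A finite history is completed by empty batches so that it can be fed to
    [miso_phi]; the values past [k] are never read. *)
Definition extend {k} (h : {ffun 'I_k -> {set 'I_n}}) (t : nat) : {set 'I_n} :=
  if insub t is Some i then h i else finset.set0.

Lemma extend_hist k w t : (t < k)%N -> extend (hist k w) t = S t w.
Proof. by move=> tk; rewrite /extend insubT /= ffunE. Qed.

Lemma hist_fiber k (h : {ffun 'I_k -> {set 'I_n}}) :
  hist k @^-1` [set h] = history S (extend h) k.
Proof.
apply/seteqP; split => w /=.
  by move=> <- t tk; rewrite extend_hist.
move=> hw; apply/ffunP => t; rewrite ffunE hw //.
by rewrite /extend valK.
Qed.

Lemma measurable_history s k : measurable (history S s k).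
Proof.
case: S_draws => mS _ _.
elim: k => [|k IHk].
  by rewrite (_ : history S s 0 = setT) //; apply/seteqP; split.
rewrite (_ : history S s k.+1 = history S s k `&` S k @^-1` [set s k]).
  exact: measurableI.
apply/seteqP; split => w /=.
  by move=> h; split => [j jk|]; apply: h => //; exact: ltnW.
by move=> [h hk] j; rewrite ltnS leq_eqVlt => /orP[/eqP ->//|]; exact: h.
Qed.

Lemma measurable_hist k h : measurable (hist k @^-1` [set h]).
Proof. by rewrite hist_fiber; exact: measurable_history. Qed.

Lemma law_draw k : law P (S k) = p.
Proof. by case: S_draws => _ Sp _; apply/funext => A; rewrite /law Sp. Qed.

Variables (f : 'I_n -> 'rV[R]_d -> R) (gamma : R) (phi0 : 'I_n -> 'rV[R]_d).

Lemma miso_phi_eq s s' k : (forall t, (t < k)%N -> s t = s' t) ->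
  miso_phi f gamma phi0 s k = miso_phi f gamma phi0 s' k.
Proof.
elim: k => [//|k IHk] ss' /=; rewrite ss' // IHk // => t tk.
by apply: ss'; exact: ltnW.
Qed.

(** The mean of [F] over the state after [k] steps, as a finite sum over
    histories: means can then be manipulated in [R], free of integrability. *)
Definition miso_mean k (F : ('I_n -> 'rV[R]_d) -> R) : R :=
  \sum_h law P (hist k) h * F (miso_phi f gamma phi0 (extend h) k).

Lemma expectation_miso k F :
  ('E_P[fun w => F (miso_phi f gamma phi0 (fun t => S t w) k)]
   = (miso_mean k F)%:E)%E.
Proof.
rewrite /miso_mean -(expectation_finite P _
  (fun h => F (miso_phi f gamma phi0 (extend h) k))); last exact: measurable_hist.
congr expectation; apply/funext => w; congr F.
by apply: miso_phi_eq => t tk; rewrite extend_hist.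
Qed.

Lemma miso_mean0 F : miso_mean 0 F = F phi0.
Proof.
by apply: EFin_inj; rewrite -expectation_miso -(expectation_cst P).
Qed.

Lemma miso_mean_cst k r : miso_mean k (fun=> r) = r.
Proof.
by apply: EFin_inj; rewrite -expectation_miso -[RHS](expectation_cst P).
Qed.

(** The Markov property: the batch drawn at step [k] is independent of the
    history that determines the state. *)
Lemma miso_meanS k F : miso_mean k.+1 F =
  miso_mean k (fun phi => sampling_mean p (fun A => F (miso_step f gamma phi A))).
Proof.
case: S_draws => mS _ indep.
apply: EFin_inj; rewrite -expectation_miso.
pose G h A := F (miso_step f gamma (miso_phi f gamma phi0 (@extend k h) k) A).
transitivity ('E_P[fun w => G (hist k w) (S k w)])%E.
  congr expectation; apply/funext => w; rewrite /G; congr F.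
  by rewrite (@miso_phi_eq _ (fun t => S t w)) // => t tk; rewrite extend_hist.
rewrite expectation_indep; first by rewrite law_draw.
- exact: measurable_hist.
- exact: mS.
- by move=> h A; rewrite hist_fiber indep.
Qed.

Lemma miso_mean_le k F G : (forall phi, F phi <= G phi) ->
  miso_mean k F <= miso_mean k G.
Proof.
by move=> FG; apply: ler_sum => h _; rewrite ler_wpM2l // law_ge0.
Qed.

Lemma miso_meanB k F G :
  miso_mean k (fun phi => F phi - G phi) = miso_mean k F - miso_mean k G.
Proof. by rewrite -sumrB; apply: eq_bigr => h _; rewrite mulrBr. Qed.

Lemma miso_meanZ k r F :
  miso_mean k (fun phi => r * F phi) = r * miso_mean k F.
Proof. by rewrite mulr_sumr; apply: eq_bigr => h _; rewrite mulrCA. Qed.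

(** Any potential that drops by [D] in conditional mean pays for the sum of the
    means of [D] along the run. *)
Lemma miso_mean_sum_le m V D :
  (forall phi, 0 <= V phi) ->
  (forall phi, sampling_mean p (fun A => V (miso_step f gamma phi A))
     <= V phi - D phi) ->
  \sum_(j < m) miso_mean j D <= V phi0.
Proof.
move=> V0 drift.
suff : \sum_(j < m) miso_mean j D <= V phi0 - miso_mean m V.
  move/le_trans; apply; rewrite gerBl -(miso_mean_cst m 0).
  exact: miso_mean_le.
elim: m => [|m IHm]; first by rewrite big_ord0 miso_mean0 subrr.
rewrite big_ord_recr /=.
have : miso_mean m.+1 V <= miso_mean m V - miso_mean m D.
  by rewrite miso_meanS -miso_meanB; exact: miso_mean_le.
by move: IHm; lra.
Qed.

Lemma expectation_random_iterate k (a : Omega -> 'I_k.+1) F :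
  uniform_index P a -> independent_index P S a ->
  ('E_P[fun w => F (miso_phi f gamma phi0 (fun t => S t w) (a w))]
   = (k.+1%:R^-1 * \sum_(i < k.+1) miso_mean i F)%:E)%E.
Proof.
move=> [ma Pa] indep.
pose G (i : 'I_k.+1) h := F (miso_phi f gamma phi0 (@extend k h) i).
transitivity ('E_P[fun w => G (a w) (hist k w)])%E.
  congr expectation; apply/funext => w; rewrite /G; congr F.
  apply: miso_phi_eq => t ta; rewrite extend_hist //.
  by rewrite (leq_trans ta) // -ltnS.
rewrite expectation_indep //; last 2 first.
- exact: measurable_hist.
- by move=> i h; rewrite hist_fiber indep.
congr EFin; rewrite mulr_sumr; apply: eq_bigr => i _.
rewrite {1}/law Pa /=; congr (_ * _).
apply: EFin_inj; rewrite -expectation_miso -(expectation_finite P _ (G i)) //.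
  congr expectation; apply/funext => w; rewrite /G; congr F.
  apply: miso_phi_eq => t ti; rewrite extend_hist //.
  by rewrite (leq_trans ti) // -ltnS.
exact: measurable_hist.
Qed.

End History.

(** * The convergence rate *)

Theorem theorem5p5 (R : realType) (n d : nat) (n_gt0 : (0 < n)%N)
  (f : 'I_n -> 'rV[R]_d -> R) (Lf L : R) (Lf_ge0 : 0 <= Lf) (L_ge0 : 0 <= L)
  (favg_convex : convex_function [set: 'rV[R]_d] (favg f : 'rV[R]_d -> R^o))
  (favg_smooth : smooth Lf (favg f))
  (f_convex : forall i, convex_function [set: 'rV[R]_d] (f i : 'rV[R]_d -> R^o))
  (f_smooth : forall i, smooth L (f i))
  (xstar : 'rV[R]_d) (xstar_min : forall x, favg f xstar <= favg f x)
  (p : {set 'I_n} -> R) (p_sampling : sampling p)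
  (p_proper : proper_sampling p) (p_uniform : uniform_sampling p)
  (tau : R) (tauE : tau = batch_size p)
  (A B : R) (A_ge0 : 0 <= A) (B_ge0 : 0 <= B)
  (AB_bound : forall a : 'I_n -> 'rV[R]_d,
    sampling_mean p
      (fun S => enorm (\sum_(i in S) (incl_prob p i)^-1 *: a i) ^+ 2)
    <= A * (\sum_(i < n) enorm (a i) ^+ 2) + B * enorm (\sum_(i < n) a i) ^+ 2)
  (AB_gt0 : 0 < B * Lf + 4 * A * L / n%:R)
  (gamma : R)
  (gammaE : gamma = n%:R / (2 * tau * (B * Lf + 4 * A * L / n%:R)))
  (phi0 : 'I_n -> 'rV[R]_d)
  (disp : measure_display) (Omega : measurableType disp)
  (P : probability Omega R)
  (S : nat -> Omega -> {set 'I_n}) (S_draws : independent_draws P p S)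
  (k : nat) (a : Omega -> 'I_k.+1) (a_uniform : uniform_index P a)
  (a_indep : independent_index P S a) :
  let x (j : nat) (w : Omega) : 'rV[R]_d :=
    miso_x f gamma phi0 (fun t => S t w) j in
  let x0 : 'rV[R]_d := miso_point f gamma phi0 in
  let W0 : R := \sum_(i < n)
    enorm (phi0 i - xstar - gamma *: gradient (f i) (phi0 i)
           + gamma *: gradient (f i) xstar) ^+ 2 in
  ('E_P[fun w => favg f (x (a w) w)] - (favg f xstar)%:E <=
   (2 * (B * Lf + 4 * A * L / n%:R)
    * ((enorm (x0 - xstar) ^+ 2 + 2 * A * tau / n%:R ^+ 3 * W0)
       / k.+1%:R))%:E)%E.
Proof.
cbv zeta; set x0 := miso_point f gamma phi0; set W0 := \sum_(i < n) _.
pose q := incl_prob p (Ordinal n_gt0).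
have q_gt0 : 0 < q by exact: p_proper.
have inclE i : incl_prob p i = q by exact: p_uniform.
pose K := B * Lf + 4 * A * L / n%:R.
have n_neq0 : n%:R != 0 :> R by rewrite pnatr_eq0 -lt0n.
have q_neq0 : q != 0 by rewrite gt_eqF.
have K_neq0 : K != 0 by rewrite gt_eqF.
have tau_eq : tau = n%:R * q.
  rewrite tauE batch_size_sum; under eq_bigr do rewrite inclE.
  by rewrite sumr_const card_ord mulr_natl.
have gamma_eq : gamma = (2 * q * K)^-1.
  by rewrite gammaE tau_eq -/K; field; rewrite n_neq0 q_neq0 K_neq0.
pose c := 2 * A * q / n%:R ^+ 2.
have V0E : lyapunov f gamma xstar c phi0
    = enorm (x0 - xstar) ^+ 2 + 2 * A * tau / n%:R ^+ 3 * W0.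
  have -> : 2 * A * tau / n%:R ^+ 3 = c by rewrite tau_eq /c; field.
  congr (_ + c * _); apply: eq_bigr => i _; congr (enorm _ ^+ 2).
  by rewrite /gstep opprB addrA addrAC (addrAC (phi0 i)).
pose gap phi := favg f (miso_point f gamma phi) - favg f xstar.
have drift phi :
    sampling_mean p (fun T => lyapunov f gamma xstar c (miso_step f gamma phi T))
    <= lyapunov f gamma xstar c phi - q * gamma * gap phi.
  exact: (lyapunov_drift f Lf L n_gt0 Lf_ge0 L_ge0 favg_convex favg_smooth f_convex
    f_smooth xstar xstar_min p q A B gamma p_sampling q_gt0 inclE A_ge0 B_ge0).
have c_ge0 : 0 <= c by rewrite /c !mulr_ge0 ?invr_ge0 ?exprn_ge0 // ltW.
have mean_le := miso_mean_sum_le P p S S_draws f gamma phi0 k.+1 _ _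
  (fun phi => lyapunov_ge0 f gamma xstar c phi c_ge0) drift.
rewrite (expectation_random_iterate P p S S_draws f gamma phi0 k a
  (fun phi => favg f (miso_point f gamma phi)) a_uniform a_indep).
rewrite -EFinB lee_fin.
have gapE :
    \sum_(j < k.+1) miso_mean P S f gamma phi0 j (fun phi => q * gamma * gap phi)
    = q * gamma * (\sum_(j < k.+1) miso_mean P S f gamma phi0 j
        (fun phi => favg f (miso_point f gamma phi)) - k.+1%:R * favg f xstar).
  rewrite (_ : k.+1%:R * favg f xstar = \sum_(j < k.+1) favg f xstar); last first.
    by rewrite sumr_const card_ord mulr_natl.
  rewrite -sumrB mulr_sumr; apply: eq_bigr => j _.
  rewrite miso_meanZ; congr (_ * _).
  by rewrite (miso_meanB P S f gamma phi0 j _ (fun=> favg f xstar))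
    (miso_mean_cst P p S S_draws).
rewrite gapE V0E in mean_le.
move: mean_le; set M := \sum_(j < k.+1) _; set V0 := _ + _ * W0.
have -> : q * gamma = (2 * K)^-1.
  by rewrite gamma_eq; field; rewrite q_neq0 K_neq0.
have k_gt0 : 0 < k.+1%:R :> R by rewrite ltr0n.
rewrite ler_pdivrMl ?mulr_gt0 // => mean_le.
rewrite mulrA ler_pdivlMr // mulrBl mulrAC mulVf ?gt_eqF // mul1r.
by rewrite (mulrC (favg f xstar)).
Qed.
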